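(* Let $G$ be a matrix Lie group with Lie algebra $\mathfrak{g}$ of dimension $n$. Let $X(t),\bar X(t)\in G$ be differentiable and satisfy $$\dot X = X[l]^\wedge + [r]^\wedge X,\qquad \dot{\bar X} = \bar X[\bar l]^\wedge + [\bar r]^\wedge \bar X,$$ where $l,r,\bar l,\bar r:\mathbb{R}\to\mathbb{R}^n$ are (possibly time-varying) inputs, and write $l=\bar l+u_l$, $r=\bar r+u_r$. Define the left-invariant error $\eta_l = X^{-1}\bar X$ and suppose $\eta_l(t)=\exp([\zeta_l(t)]^\wedge)$ for a differentiable curve $\zeta_l(t)\in\mathbb{R}^n$ such that the linear map $\sum_{k\ge 0}\frac{(-1)^k}{(k+1)!}(ad_{[\zeta_l]^\wedge})^k$ is invertible (equivalently, $ad_{[\zeta_l]^\wedge}$ has no eigenvalue in $2\pi i\mathbb{Z}\setminus\{0\}$). Then $$\dot\zeta_l = -ad_{[\bar l]^\wedge}\,\zeta_l + U_l\,\big(u_l + Ad_{X^{-1}}u_r\big),\qquad U_l \equiv -\frac{ad_{[\zeta_l]^\wedge}\exp(-ad_{[\zeta_l]^\wedge})}{I-\exp(-ad_{[\zeta_l]^\wedge})},$$ and $U_l$ is invertible with $$U_l^{-1} = -\sum_{k=0}^{\infty}\frac{(ad_{[\zeta_l]^\wedge})^k}{(k+1)!}.$$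
   Context: $[\cdot]^\wedge:\mathbb{R}^n\to\mathfrak{g}$ is a fixed linear isomorphism (the ''wedge'' map) with inverse $[\cdot]^\vee$. For $\zeta\in\mathbb{R}^n$, $ad_{[\zeta]^\wedge}$ denotes the $n\times n$ matrix of the linear map $y\mapsto\big([\zeta]^\wedge[y]^\wedge-[y]^\wedge[\zeta]^\wedge\big)^\vee$. For $X\in G$, $Ad_X$ denotes the $n\times n$ matrix of $y\mapsto (X[y]^\wedge X^{-1})^\vee$. $\exp$ is the matrix exponential. Expressions such as $\frac{ad\,\exp(-ad)}{I-\exp(-ad)}$ are understood as the matrix functions defined via power series in $ad_{[\zeta_l]^\wedge}$ (all such factors commute); in particular $\frac{I-\exp(-ad)}{ad}=\sum_{k\ge0}\frac{(-1)^k}{(k+1)!}ad^k$ and $\frac{ad}{I-\exp(-ad)}$ is its inverse. *)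

(* Defs.v *)
From HB Require Import structures.
From mathcomp Require Import all_boot all_order all_algebra.
From mathcomp Require Import all_classical all_reals all_analysis.
Set Implicit Arguments. Unset Strict Implicit. Unset Printing Implicit Defensive.
Import Order.TTheory GRing.Theory Num.Theory.
Import numFieldNormedType.Exports.
Local Open Scope classical_set_scope.
Local Open Scope ring_scope.

Definition mxseries (R : realType) (p q : nat) (F : nat -> 'M[R]_(p, q)) : 'M[R]_(p, q) :=
  limn (fun N => \sum_(k < N) F k).

Definition expm (R : realType) (p : nat) (A : 'M[R]_p) : 'M[R]_p :=
  mxseries (fun k => (k`!%:R)^-1 *: (A ^+ k)).

Definition mx_of_lin (R : realType) (n : nat) (f : 'cV[R]_n -> 'cV[R]_n) : 'M[R]_n :=
  \matrix_(i, j) f (delta_mx j 0) i 0.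

Definition matrix_Lie_group (R : realType) (m : nat) (G : set 'M[R]_m) : Prop :=
  [/\ G 1%:M,
      (forall A, G A -> A \in unitmx),
      (forall A B, G A -> G B -> G (A *m B)),
      (forall A, G A -> G (invmx A)) &
      (forall A, closure G A -> A \in unitmx -> G A)].

Definition lie_algebra (R : realType) (m : nat) (G : set 'M[R]_m) : set 'M[R]_m :=
  [set A | forall t : R, G (expm (t *: A))].

Definition ad_mx (R : realType) (m n : nat) (wedge : 'cV[R]_n -> 'M[R]_m)
  (vee : 'M[R]_m -> 'cV[R]_n) (z : 'cV[R]_n) : 'M[R]_n :=
  mx_of_lin (fun y => vee (wedge z *m wedge y - wedge y *m wedge z)).

Definition Ad_mx (R : realType) (m n : nat) (wedge : 'cV[R]_n -> 'M[R]_m)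
  (vee : 'M[R]_m -> 'cV[R]_n) (X : 'M[R]_m) : 'M[R]_n :=
  mx_of_lin (fun y => vee (X *m wedge y *m invmx X)).

(* (I - exp(-ad))/ad = sum_k (-1)^k/(k+1)! ad^k *)
Definition dexp_series (R : realType) (n : nat) (M : 'M[R]_n) : 'M[R]_n :=
  mxseries (fun k => ((-1) ^+ k / (k.+1)`!%:R) *: (M ^+ k)).

(* U = - ad exp(-ad) / (I - exp(-ad)) = - exp(-ad) * ((I - exp(-ad))/ad)^{-1} *)
Definition U_mx (R : realType) (n : nat) (M : 'M[R]_n) : 'M[R]_n :=
  - (expm (- M) *m invmx (dexp_series M)).

(* Main.v *)
(** With Z = [zeta]^ and M = ad_zeta, the heart of the matter is
    d/dt exp(Z) = exp(Z) [D(M) zeta']^, where D(M) = sum_k (-1)^k M^k / (k+1)!.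

    Since A^(n+1) - B^(n+1) = sum_i A^(n-i) (A - B) B^i, a dominated-convergence
    argument on the exponential series gives
    d/dt exp(Z) = sum_n 1/(n+1)! sum_i Z^(n-i) Z' Z^i.
    The matrices W_k = [(-M)^k y]^ satisfy W_k Z = Z W_k + W_(k+1), and for every
    sequence with W_k B = L W_k + W_(k+1) Pascal's rule expands W_0 B^n and
    sum_i L^(n-i) W_0 B^i in the products L^(n-k) W_k. Cauchy products then yield
    exp(L) sum_k W_k / k! = W_0 exp(B) and
    exp(L) sum_k W_k / (k+1)! = sum_n 1/(n+1)! sum_i L^(n-i) W_0 B^i.
    Besides the derivative of exp(Z) and Ad_exp(-Z) = exp(-M), taking B = 0 and
    W_k = (-M)^k gives exp(M) exp(-M) = 1 and exp(M) D(M) = sum_k M^k / (k+1)!.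

    Differentiating Xbar = X exp(Z) yields
    D(M) zeta' = lbar - exp(-M) (lbar + u_l + Ad_(X^-1) u_r), and the theorem
    follows from D(M) M = 1 - exp(-M). *)

Require Import Defs.
From HB Require Import structures.
From mathcomp Require Import all_boot all_order all_algebra.
From mathcomp Require Import all_classical all_reals all_analysis.
From mathcomp Require Import ring.
Import Order.TTheory GRing.Theory Num.Theory.
Import numFieldNormedType.Exports.
Local Open Scope classical_set_scope.
Local Open Scope ring_scope.

Set Implicit Arguments.
Unset Strict Implicit.

(** * Limits of matrices and dominated series *)

Lemma mx_entry_le_norm (R : realType) (p q : nat) (A : 'M[R]_(p, q)) i j :
  `|A i j| <= `|A|.
Proof.
rewrite [leRHS]/Num.norm /= mx_normrE; apply/bigmax_geP; right => /=.
by exists (i, j).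
Qed.

Lemma mx_norm_le (R : realType) (p q : nat) (A : 'M[R]_(p, q)) (b : R) :
  0 <= b -> (forall i j, `|A i j| <= b) -> `|A| <= b.
Proof.
move=> b0 Ab; rewrite [leLHS]/Num.norm /= mx_normrE.
by apply/bigmax_leP; split => // -[i j] _; exact: Ab.
Qed.

(** The norm is the largest absolute value of an entry, which is not submultiplicative; each entry
    of the product sums [q] terms, hence the factor [q]. *)
Lemma mx_norm_mul (R : realType) (p q r : nat)
    (A : 'M[R]_(p, q)) (B : 'M[R]_(q, r)) :
  `|A *m B| <= q%:R * `|A| * `|B|.
Proof.
apply: mx_norm_le => [|i j]; first by rewrite !mulr_ge0.
rewrite mxE; apply: le_trans (ler_norm_sum _ _ _) _.
rewrite -mulrA mulr_natl -[X in _ *+ X]card_ord -sumr_const.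
apply: ler_sum => k _; rewrite normrM.
by apply: ler_pM => //; exact: mx_entry_le_norm.
Qed.

Lemma mxexpS (R : realType) (p : nat) (A : 'M[R]_p) k : A ^+ k.+1 = A *m A ^+ k.
Proof. exact: exprS. Qed.

Lemma mxexpSr (R : realType) (p : nat) (A : 'M[R]_p) k : A ^+ k.+1 = A ^+ k *m A.
Proof. exact: exprSr. Qed.

Lemma mx_norm_exp (R : realType) (p : nat) (A : 'M[R]_p) (a : R) k :
  p%:R * `|A| <= a -> `|A ^+ k| <= a ^+ k.
Proof.
move=> Aa; have a0 : 0 <= a by apply: le_trans Aa; rewrite mulr_ge0.
elim: k => [|k IH].
  apply: mx_norm_le; rewrite ?expr0// => i j.
  by rewrite mxE; case: (i == j); rewrite ?normr1// normr0.
rewrite mxexpS exprS; apply: le_trans (mx_norm_mul _ _) _.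
by apply: ler_pM => //; rewrite mulr_ge0.
Qed.

Section Limits.
Context {R : realType} {T : Type} {F : set_system T} {FF : Filter F}.

Lemma cvg_sumr (V : normedModType R) (I : Type) (s : seq I) (P : pred I)
    (f : I -> T -> V) (l : I -> V) :
  (forall i, P i -> f i x @[x --> F] --> l i) ->
  \sum_(i <- s | P i) f i x @[x --> F] --> \sum_(i <- s | P i) l i.
Proof.
move=> fl; elim: s => [|i s IH].
  by rewrite big_nil; under eq_fun do rewrite big_nil; exact: cvg_cst.
rewrite big_cons; under eq_fun do rewrite big_cons.
by case: ifP => // Pi; apply: cvgD => //; exact: fl.
Qed.

Lemma cvg_entry (p q : nat) (f : T -> 'M[R]_(p, q)) (l : 'M[R]_(p, q)) i j :
  f x @[x --> F] --> l -> f x i j @[x --> F] --> l i j.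
Proof.
move=> fl; apply: (@continuous_cvg _ _ _ F FF f (fun M => M i j) l _ fl).
exact: coord_continuous.
Qed.

(** Continuity comes from finite dimension: [g M] is a finite combination of the fixed matrices
    [g (delta_mx i j)] with the entries of [M] as coefficients. *)
Lemma cvg_linear (p q r s : nat) (g : {linear 'M[R]_(p, q) -> 'M[R]_(r, s)})
    (f : T -> 'M[R]_(p, q)) (l : 'M[R]_(p, q)) :
  f x @[x --> F] --> l -> g (f x) @[x --> F] --> g l.
Proof.
move=> fl.
have gE M : g M = \sum_i \sum_j M i j *: g (delta_mx i j).
  rewrite {1}(matrix_sum_delta M) linear_sum; apply: eq_bigr => i _.
  by rewrite linear_sum; apply: eq_bigr => j _; rewrite linearZ.
rewrite gE; under eq_fun do rewrite gE.
apply: cvg_sumr => i _; apply: cvg_sumr => j _.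
by apply: cvgZr_tmp; exact: cvg_entry.
Qed.

Lemma cvg_mx (p q : nat) (f : T -> 'M[R]_(p, q)) (l : 'M[R]_(p, q)) :
  (forall i j, f x i j @[x --> F] --> l i j) -> f x @[x --> F] --> l.
Proof.
move=> fl; rewrite (matrix_sum_delta l).
under eq_fun do rewrite (matrix_sum_delta (f _)).
apply: cvg_sumr => i _; apply: cvg_sumr => j _.
by apply: cvgZr_tmp; exact: fl.
Qed.

Lemma cvg_mulmx (p q r : nat) (f : T -> 'M[R]_(p, q)) (g : T -> 'M[R]_(q, r))
    (a : 'M[R]_(p, q)) (b : 'M[R]_(q, r)) :
  f x @[x --> F] --> a -> g x @[x --> F] --> b ->
  f x *m g x @[x --> F] --> a *m b.
Proof.
move=> fa gb; apply: cvg_mx => i j; rewrite mxE.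
under eq_fun do rewrite mxE.
by apply: cvg_sumr => k _; apply: cvgM; exact: cvg_entry.
Qed.

End Limits.

Lemma cvg_mxexp (R : realType) (T : Type) (F : set_system T) {FF : Filter F}
    (p : nat) (f : T -> 'M[R]_p) (l : 'M[R]_p) k :
  f x @[x --> F] --> l -> f x ^+ k @[x --> F] --> l ^+ k.
Proof.
move=> fl; elim: k => [|k IH]; first exact: cvg_cst.
by rewrite mxexpS; under eq_fun do rewrite mxexpS; exact: cvg_mulmx.
Qed.

(** Entries are dominated by the norm, so each entry is an absolutely convergent real series; the
    limit is assembled entrywise. *)
Lemma cvgn_normed_mx_series (R : realType) (p q : nat) (F : nat -> 'M[R]_(p, q)) :
  cvgn [normed series F] -> cvgn (series F).
Proof.
move=> cF; apply/cvg_ex.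
exists (\matrix_(i, j) limn (series (fun k => F k i j))).
apply: cvg_mx => i j; rewrite mxE.
have -> : (fun N => series F N i j) = series (fun k => F k i j).
  by apply/funext => N; rewrite /series /= summxE.
apply: normed_cvg; apply: series_le_cvg cF => n //=.
exact: mx_entry_le_norm.
Qed.

Lemma cvgn_series_norm_le (R : realType) (p q : nat) (F : nat -> 'M[R]_(p, q))
    (M : nat -> R) :
  (forall k, `|F k| <= M k) -> cvgn (series M) -> cvgn [normed series F].
Proof.
move=> FM cM; apply: (series_le_cvg _ _ FM cM) => n //.
by apply: le_trans (FM n).
Qed.

Lemma mxseries_tail (R : realType) (p q : nat) (F : nat -> 'M[R]_(p, q))
    (M : nat -> R) N :
  (forall k, `|F k| <= M k) -> cvgn (series M) ->
  `|limn (series F) - series F N| <= limn (series M) - series M N.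
Proof.
move=> FM cM.
have cF := cvgn_normed_mx_series (cvgn_series_norm_le FM cM).
have h : `|series F n - series F N| @[n --> \oo] -->
    `|limn (series F) - series F N|.
  by apply: cvg_norm; apply: cvgB => //; exact: cvg_cst.
apply: (cvgr_to_le h); near=> n.
have Nn : (N <= n)%N by near: n; exact: nbhs_infty_ge.
rewrite sub_series_geq //.
apply: le_trans (ler_norm_sum _ _ _) _.
apply: (@le_trans _ _ (series M n - series M N)).
  by rewrite sub_series_geq //; apply: ler_sum.
rewrite lerD2r; apply: nondecreasing_cvgn_le => //.
apply/nondecreasing_seqP => k; rewrite seriesSr lerDl.
exact: le_trans (normr_ge0 _) (FM k).
Unshelve. all: by end_near. Qed.

(** Tannery's theorem: up to a tail controlled uniformly in [x] by the tail of [M], only a finite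
    sum has to converge. *)
Lemma dominated_mxseries_cvg (R : realType) (T : Type) (F : set_system T)
    {FF : ProperFilter F} (p q : nat) (f : T -> nat -> 'M[R]_(p, q))
    (g : nat -> 'M[R]_(p, q)) (M : nat -> R) :
  cvgn (series M) ->
  (\forall x \near F, forall k, `|f x k| <= M k) ->
  (forall k, f x k @[x --> F] --> g k) ->
  limn (series (f x)) @[x --> F] --> limn (series g).
Proof.
move=> cM fM fg.
have gM k : `|g k| <= M k.
  by apply: (cvgr_to_le (cvg_norm (fg k))); apply: filterS fM => x.
apply/cvgrPdist_le => e e0.
have e3 : 0 < e / 3 by rewrite divr_gt0.
(* The cut [N] makes the tail of [M] at most [e / 3]; the two tails and the difference of the [N]-th
   partial sums take one third each. *)
have [N _ /(_ N (leqnn N))/= HN] := (cvgrPdist_le _ _).1 cM _ e3.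
have cN : series (f x) N @[x --> F] --> series g N.
  by apply: (cvg_sumr (f := fun k x => f x k)) => k _; exact: fg.
have hN := (cvgrPdist_le _ _).1 cN _ e3.
near=> x.
have fxM : forall k, `|f x k| <= M k by near: x.
have hx : `|series g N - series (f x) N| <= e / 3 by near: x; exact: hN.
rewrite (_ : _ - _ = (limn (series g) - series g N) +
  (series g N - series (f x) N) - (limn (series (f x)) - series (f x) N)); last first.
  by rewrite addrA subrK opprB addrA subrK.
apply: le_trans (ler_normB _ _) _.
have tl : limn (series M) - series M N <= e / 3 by apply: le_trans HN; exact: ler_norm.
rewrite (_ : e = e / 3 + e / 3 + e / 3); last by field.
rewrite lerD //; last exact: le_trans (mxseries_tail N fxM cM) tl.
apply: le_trans (ler_normD _ _) _; rewrite lerD //.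
exact: le_trans (mxseries_tail N gM cM) tl.
Unshelve. all: by end_near. Qed.

(** * Matrix series, Cauchy products and intertwining sequences *)

Lemma mxseriesE (R : realType) (p q : nat) (F : nat -> 'M[R]_(p, q)) :
  mxseries F = limn (series F).
Proof.
by rewrite /mxseries; congr (lim (_ @ \oo)); apply/funext => N; rewrite /series/= big_mkord.
Qed.

Lemma cvg_mxseries (R : realType) (p q : nat) (F : nat -> 'M[R]_(p, q)) :
  cvgn [normed series F] -> series F @ \oo --> mxseries F.
Proof. by rewrite mxseriesE; exact: cvgn_normed_mx_series. Qed.

Lemma eq_mxseries (R : realType) (p q : nat) (F G : nat -> 'M[R]_(p, q)) :
  F =1 G -> mxseries F = mxseries G.
Proof. by move=> FG; congr mxseries; exact/funext. Qed.

Lemma mxseries_linear (R : realType) (p q r s : nat)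
    (g : {linear 'M[R]_(p, q) -> 'M[R]_(r, s)}) (F : nat -> 'M[R]_(p, q)) :
  cvgn [normed series F] -> mxseries (fun k => g (F k)) = g (mxseries F).
Proof.
move=> cF; rewrite mxseriesE; apply: cvg_lim => //.
have -> : series (fun k => g (F k)) = (fun N => g (series F N)).
  by apply/funext => N; rewrite /series/= linear_sum.
by apply: cvg_linear; exact: cvg_mxseries.
Qed.

Lemma mxseries_recl (R : realType) (p q : nat) (F : nat -> 'M[R]_(p, q)) :
  cvgn [normed series (fun k => F k.+1)] ->
  mxseries F = F 0 + mxseries (fun k => F k.+1).
Proof.
move=> cF; rewrite mxseriesE; apply: cvg_lim => //.
rewrite -cvg_shiftS /=.
have -> : (fun N => series F N.+1) = (fun N => F 0 + series (fun k => F k.+1) N).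
  by apply/funext => N; rewrite /series/= big_nat_recl.
by apply: cvgD; [exact: cvg_cst|exact: cvg_mxseries].
Qed.

Lemma mxseries1 (R : realType) (p q : nat) (F : nat -> 'M[R]_(p, q)) :
  (forall k, F k.+1 = 0) -> mxseries F = F 0.
Proof.
move=> F0; rewrite mxseriesE; apply: cvg_lim => //; rewrite -cvg_shiftS /=.
rewrite (_ : (fun _ => _) = fun=> F 0); first exact: cvg_cst.
by apply/funext => N; rewrite /series/= big_nat_recl//= big1 ?addr0.
Qed.

Lemma linear_mx_bounded (R : realType) (p q r s : nat)
    (g : {linear 'M[R]_(p, q) -> 'M[R]_(r, s)}) :
  exists2 C : R, 0 <= C & forall v, `|g v| <= C * `|v|.
Proof.
exists (\sum_i \sum_j `|g (delta_mx i j)|) => [|v].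
  by apply: sumr_ge0 => i _; exact: sumr_ge0.
rewrite {1}(matrix_sum_delta v) linear_sum mulr_suml.
apply: le_trans (ler_norm_sum _ _ _) _; apply: ler_sum => i _.
rewrite linear_sum mulr_suml.
apply: le_trans (ler_norm_sum _ _ _) _; apply: ler_sum => j _.
by rewrite linearZ normrZ mulrC ler_wpM2l// mx_entry_le_norm.
Qed.

(** The triangle is summed along [i] instead of [n]: for fixed [i], the left factors are [F 0] up to
    [F (N - i - 1)]. *)
Lemma cauchy_sum_mulmx (R : realType) (p q r : nat)
    (F : nat -> 'M[R]_(p, q)) (G : nat -> 'M[R]_(q, r)) N :
  \sum_(n < N) \sum_(i < n.+1) F (n - i)%N *m G i =
  \sum_(i < N) series F (N - i)%N *m G i.
Proof.
elim: N => [|N IH]; first by rewrite !big_ord0.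
rewrite big_ord_recr/= IH [in RHS]big_ord_recr/= subSnn.
rewrite [X in _ + X = _]big_ord_recr/= subnn addrA -big_split/=; congr (_ + _).
  apply: eq_bigr => i _; rewrite -mulmxDl; congr (_ *m _).
  by rewrite subSn 1?ltnW// seriesSr.
by rewrite /series/= big_nat1.
Qed.

(** By [cauchy_sum_mulmx] the [N]-th partial sum is a series in [i] whose terms tend to
    [mxseries F *m G i] and are dominated by a multiple of [|G i|], so dominated convergence
    applies. *)
Lemma mxseries_cauchy (R : realType) (p q r : nat)
    (F : nat -> 'M[R]_(p, q)) (G : nat -> 'M[R]_(q, r)) :
  cvgn [normed series F] -> cvgn [normed series G] ->
  mxseries (fun n => \sum_(i < n.+1) F (n - i)%N *m G i) =
  mxseries F *m mxseries G.
Proof.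
move=> cF cG; rewrite mxseriesE; apply: cvg_lim => //.
pose K : R := limn [normed series F].
have FK n : `|series F n| <= K.
  apply: le_trans (ler_norm_sum _ _ _) _.
  apply: (nondecreasing_cvgn_le (u_ := series (fun n => `|F n|))) => //.
  by apply/nondecreasing_seqP => k; rewrite seriesSr lerDl.
have K0 : 0 <= K by apply: le_trans (FK 0%N).
pose f N i := series F (N - i)%N *m G i.
(* For [i >= N] the truncated difference [N - i] is 0 and [series F 0] is the empty sum, so the
   finite sum is already the full series in [i]. *)
have -> : series (fun n => \sum_(i < n.+1) F (n - i)%N *m G i) =
    (fun N => limn (series (f N))).
  apply/funext => N; rewrite /series/= big_mkord cauchy_sum_mulmx.
  apply/esym/lim_near_cst => //; near=> n.
  have Nn : (N <= n)%N by near: n; exact: nbhs_infty_ge.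
  rewrite (big_cat_nat (n := N))//= big_mkord [X in _ + X]big1_seq ?addr0//.
  move=> i /andP[_]; rewrite mem_index_iota => /andP[Ni _]; rewrite /f.
  have -> : (N - i = 0)%N by apply/eqP.
  by rewrite /series/= big_geq// mul0mx.
have <- : mxseries (fun i => mxseries F *m G i) = mxseries F *m mxseries G.
  exact: (mxseries_linear (mulmx (mxseries F))).
rewrite mxseriesE.
apply: (@dominated_mxseries_cvg _ _ _ _ _ _ _ _ (fun i => q%:R * K * `|G i|)).
- rewrite (_ : series _ = series ((q%:R * K) *: (fun i => `|G i|)))//.
  exact: is_cvg_seriesZ.
- near=> N => i; apply: le_trans (mx_norm_mul _ _) _.
  by rewrite ler_wpM2r// ler_wpM2l.
- move=> i; apply: cvg_mulmx; last exact: cvg_cst.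
  have := cvg_mxseries cF; rewrite -(cvg_centern i).
Unshelve. all: by end_near. Qed.

Lemma cvgn_series_fact (R : realType) (p q : nat) (W : nat -> 'M[R]_(p, q)) (C c : R) :
  (forall k, `|W k| <= C * c ^+ k) ->
  cvgn [normed series (fun k => (k`!%:R)^-1 *: W k)].
Proof.
move=> WC; apply: (cvgn_series_norm_le (M := C *: exp_coeff c)); last first.
  by apply: is_cvg_seriesZ; exact: is_cvg_series_exp_coeff.
move=> k; rewrite [leRHS](_ : _ = C * c ^+ k * (k`!%:R)^-1); last exact: mulrA.
by rewrite normrZ ger0_norm ?invr_ge0// mulrC ler_wpM2r ?invr_ge0.
Qed.

Lemma cvgn_series_factS (R : realType) (p q : nat) (W : nat -> 'M[R]_(p, q)) (C c : R) :
  (forall k, `|W k| <= C * c ^+ k) ->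
  cvgn [normed series (fun k => (k.+1`!%:R)^-1 *: W k)].
Proof.
move=> WC; apply: cvgn_series_norm_le (cvgn_series_fact WC) => k.
rewrite /= !normrZ ler_wpM2r// !ger0_norm ?invr_ge0//.
by rewrite lef_pV2 ?posrE ?ltr0n ?fact_gt0// ler_nat factS leq_pmull.
Qed.

Lemma mx_norm_exp1 (R : realType) (p : nat) (A : 'M[R]_p) k :
  `|A ^+ k| <= 1 * (p%:R * `|A|) ^+ k.
Proof. by rewrite mul1r; exact: mx_norm_exp. Qed.

(** For [L = B] this is the derivative of the power [L ^+ n.+1] in the direction [D]; distinct ends
    serve the difference of two powers. *)
Definition sandwich (R : realType) (p q : nat) (L : 'M[R]_p) (D : 'M[R]_(p, q))
    (B : 'M[R]_q) (n : nat) : 'M[R]_(p, q) :=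
  \sum_(i < n.+1) L ^+ (n - i) *m D *m B ^+ i.

Lemma sandwichS (R : realType) (p q : nat) (L : 'M[R]_p) (D : 'M[R]_(p, q))
    (B : 'M[R]_q) (n : nat) :
  sandwich L D B n.+1 = L *m sandwich L D B n + D *m B ^+ n.+1.
Proof.
rewrite /sandwich big_ord_recr/= subnn expr0 mul1mx; congr (_ + _).
rewrite mulmx_sumr; apply: eq_bigr => i _.
have ni : (i <= n)%N by rewrite -ltnS.
by rewrite (subSn ni) mxexpS !mulmxA.
Qed.

(** Noncommutative telescoping: one more power adds [A (A^(n+1) - B^(n+1)) + (A - B) B^(n+1)]. *)
Lemma subrX_sandwich (R : realType) (p : nat) (A B : 'M[R]_p) n :
  A ^+ n.+1 - B ^+ n.+1 = sandwich A (A - B) B n.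
Proof.
elim: n => [|n IH].
  by rewrite /sandwich big_ord1 subnn !expr0 mul1mx mulmx1 !expr1.
rewrite sandwichS -IH mulmxBr mulmxBl -!mxexpS addrA; congr (_ - _).
by rewrite subrK.
Qed.

Lemma inv_fact_bin (R : realType) (n k : nat) : (k <= n)%N ->
  (n`!%:R)^-1 * 'C(n, k)%:R = ((n - k)`!%:R)^-1 * (k`!%:R)^-1 :> R.
Proof.
move=> kn; rewrite -(bin_fact kn) !natrM.
by field; rewrite !pnatr_eq0 -!lt0n !fact_gt0 bin_gt0.
Qed.

Section Twist.
Context {R : realType} {p q : nat}.
Variables (L : 'M[R]_p) (B : 'M[R]_q) (W : nat -> 'M[R]_(p, q)).
Hypothesis WB : forall k, W k *m B = L *m W k + W k.+1.

(** Each factor [B] moved left across [W k] either becomes [L] or raises the index by one; the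
    binomial coefficient counts the ways to raise it [k] times in [n] moves. *)
Lemma twist_exp n :
  W 0 *m B ^+ n = \sum_(k < n.+1) 'C(n, k)%:R *: (L ^+ (n - k) *m W k).
Proof.
elim: n => [|n IH].
  by rewrite big_ord1 subnn bin0 scale1r mul1mx mulmx1.
rewrite mxexpSr mulmxA IH mulmx_suml.
under eq_bigr => k _.
  rewrite -scalemxAl -mulmxA WB mulmxDr mulmxA -mxexpSr scalerDr.
  have kn : (k <= n)%N by rewrite -ltnS.
  rewrite -(subSn kn); over.
rewrite big_split/= [RHS]big_ord_recl/=.
under [in RHS]eq_bigr => k _ do rewrite /= /bump /= add1n binS natrD scalerDl.
rewrite big_split /= addrA; congr (_ + _).
(* The extra top term has coefficient ['C(n, n.+1) = 0]; it aligns the range with the shifted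
   sum. *)
transitivity (\sum_(k < n.+2) 'C(n, k)%:R *: (L ^+ (n.+1 - k) *m W k)).
  by rewrite [RHS]big_ord_recr/= bin_small// scale0r addr0.
rewrite big_ord_recl/= !bin0; congr (_ + _).
Qed.

(** In [sandwichS] the old sum contributes ['C(n.+1, k.+1)] and the new summand, by [twist_exp],
    ['C(n.+1, k)]; Pascal's rule adds them. *)
Lemma sandwich_twist n :
  sandwich L (W 0) B n = \sum_(k < n.+1) 'C(n.+1, k.+1)%:R *: (L ^+ (n - k) *m W k).
Proof.
elim: n => [|n IH].
  by rewrite /sandwich !big_ord1 subnn binn scale1r !expr0 mulmx1.
rewrite sandwichS IH twist_exp mulmx_sumr.
under [in RHS]eq_bigr => k _ do rewrite binS natrD scalerDl.
rewrite big_split/=; congr (_ + _).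
rewrite [RHS]big_ord_recr/= bin_small// scale0r addr0.
apply: eq_bigr => k _; have kn : (k <= n)%N by rewrite -ltnS.
by rewrite (subSn kn) -scalemxAr mulmxA -mxexpS.
Qed.

Variables C c : R.
Hypothesis WC : forall k, `|W k| <= C * c ^+ k.

(** Divided by [n!], the coefficient ['C(n, k)] becomes [1 / ((n - k)! k!)], so [twist_exp] gives
    the [n]-th term of the Cauchy product. *)
Lemma expm_twist : expm L *m mxseries (fun k => (k`!%:R)^-1 *: W k) = W 0 *m expm B.
Proof.
rewrite /expm -mxseries_cauchy; first last.
- exact: cvgn_series_fact WC.
- exact: cvgn_series_fact (mx_norm_exp1 L).
rewrite -(mxseries_linear (mulmx (W 0))); last first.
  exact: cvgn_series_fact (mx_norm_exp1 B).
apply: eq_mxseries => n; rewrite /= -scalemxAr twist_exp scaler_sumr.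
apply: eq_bigr => k _; have kn : (k <= n)%N by rewrite -ltnS.
by rewrite -scalemxAl -scalemxAr !scalerA inv_fact_bin.
Qed.

(** As in [expm_twist], now with ['C(n.+1, k.+1) / (n+1)! = 1 / ((n - k)! (k+1)!)]. *)
Lemma expm_twist_sandwich :
  expm L *m mxseries (fun k => (k.+1`!%:R)^-1 *: W k) =
  mxseries (fun n => (n.+1`!%:R)^-1 *: sandwich L (W 0) B n).
Proof.
rewrite /expm -mxseries_cauchy; first last.
- exact: cvgn_series_factS WC.
- exact: cvgn_series_fact (mx_norm_exp1 L).
apply: eq_mxseries => n; rewrite /= sandwich_twist scaler_sumr.
apply: eq_bigr => k _; have kn : (k < n.+1)%N by [].
by rewrite -scalemxAl -scalemxAr !scalerA (inv_fact_bin R kn) subSS.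
Qed.

End Twist.

(** * The matrix exponential *)

Lemma mx_expN (R : realType) (p : nat) (M : 'M[R]_p) k :
  (- M) ^+ k = (-1) ^+ k *: M ^+ k.
Proof.
elim: k => [|k IH]; first by rewrite !expr0 scale1r.
by rewrite !mxexpS IH exprS mulN1r scaleNr -scalemxAr mulNmx scalerN.
Qed.

Lemma mxexp0S (R : realType) (p k : nat) : (0 : 'M[R]_p) ^+ k.+1 = 0.
Proof. by rewrite mxexpS mul0mx. Qed.

Lemma mxseries_comm (R : realType) (p : nat) (A : 'M[R]_p) (F : nat -> 'M[R]_p) :
  cvgn [normed series F] -> (forall k, A *m F k = F k *m A) ->
  A *m mxseries F = mxseries F *m A.
Proof.
move=> cF AF; rewrite -(mxseries_linear (mulmx A) cF).
by rewrite -[RHS](mxseries_linear (mulmxr A) cF); exact: eq_mxseries.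
Qed.

Section Expm.
Context {R : realType} {p : nat}.
Implicit Types M A B D : 'M[R]_p.

Lemma cvgn_expm M : cvgn [normed series (fun k => (k`!%:R)^-1 *: M ^+ k)].
Proof. exact: cvgn_series_fact (mx_norm_exp1 M). Qed.

Lemma expm0 : expm (0 : 'M[R]_p) = 1%:M.
Proof.
rewrite /expm mxseries1 => [|k]; first by rewrite fact0 invr1 scale1r expr0.
by rewrite mxexp0S scaler0.
Qed.

Lemma twist_expN M k :
  (- M) ^+ k *m (0 : 'M[R]_p) = M *m (- M) ^+ k + (- M) ^+ k.+1.
Proof. by rewrite mxexpS mulNmx mulmx0 subrr. Qed.

Lemma expmN M : expm M *m expm (- M) = 1%:M.
Proof.
have -> : expm (- M) = mxseries (fun k => (k`!%:R)^-1 *: (- M) ^+ k) by [].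
rewrite (expm_twist (twist_expN M) (mx_norm_exp1 (- M))).
by rewrite expr0 mul1mx expm0.
Qed.

Lemma expm_unit M : expm M \in unitmx.
Proof. by case/mulmx1_unit: (expmN M). Qed.

Lemma invmx_expm M : invmx (expm M) = expm (- M).
Proof.
by rewrite -[RHS]mul1mx -(mulVmx (expm_unit M)) -mulmxA expmN mulmx1.
Qed.

Lemma dexp_seriesE M :
  dexp_series M = mxseries (fun k => (k.+1`!%:R)^-1 *: (- M) ^+ k).
Proof. by apply: eq_mxseries => k; rewrite mx_expN scalerA mulrC. Qed.

Lemma cvgn_dexp M :
  cvgn [normed series (fun k => (k.+1`!%:R)^-1 *: (- M) ^+ k)].
Proof. exact: cvgn_series_factS (mx_norm_exp1 (- M)). Qed.

Lemma expm_mul_dexp M :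
  expm M *m dexp_series M = mxseries (fun k => (k.+1`!%:R)^-1 *: M ^+ k).
Proof.
rewrite dexp_seriesE (expm_twist_sandwich (twist_expN M) (mx_norm_exp1 (- M))).
apply: eq_mxseries => n; congr (_ *: _).
(* With right end 0 only the summand [i = 0] survives, because [0 ^+ 0 = 1]; it equals [M ^+ n]. *)
rewrite /sandwich big_ord_recl/= subn0 !expr0 !mulmx1 big1 ?addr0// => i _.
by rewrite mxexp0S mulmx0.
Qed.

(** Multiplication by [- M] shifts the series of [dexp_series M] to that of [expm (- M)] without its
    constant term. *)
Lemma dexp_mul M : dexp_series M *m M = 1%:M - expm (- M).
Proof.
pose F k := (k.+1`!%:R)^-1 *: (- M) ^+ k.+1.
have cF : cvgn [normed series F].
  apply: (cvgn_series_factS (C := p%:R * `|- M|) (c := p%:R * `|- M|)) => k.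
  by rewrite -exprS; exact: mx_norm_exp.
have -> : expm (- M) = 1%:M + mxseries F.
  by rewrite /expm mxseries_recl// fact0 invr1 scale1r expr0.
have -> : mxseries F = dexp_series M *m - M.
  rewrite dexp_seriesE -[RHS](mxseries_linear (mulmxr (- M)) (@cvgn_dexp M)).
  by apply: eq_mxseries => k; rewrite /F mxexpSr /= scalemxAl.
by rewrite mulmxN opprD opprK addrA subrr add0r.
Qed.

Lemma comm_expm_dexp A M : A *m M = M *m A ->
  expm A *m dexp_series M = dexp_series M *m expm A.
Proof.
move=> AM; rewrite dexp_seriesE; apply: (mxseries_comm (@cvgn_dexp M)) => k.
apply/esym/(mxseries_comm (@cvgn_expm A)) => j.
rewrite /= -!scalemxAl -!scalemxAr !scalerA mulrC; congr (_ *: _).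
have cMA : GRing.comm (- M) A by rewrite /GRing.comm mulNr mulrN; congr (- _).
by apply: commrX; apply/commr_sym/commrX/commr_sym.
Qed.

(** Each of the [n + 1] summands is at most [p^2 |D| c^n], and [(n + 1) / (n + 1)! = 1 / n!]. The
    ends enter only through [c], so the bound is uniform on bounded sets. *)
Lemma mx_norm_sandwich A D B (c : R) n :
  p%:R * `|A| <= c -> p%:R * `|B| <= c ->
  `|(n.+1`!%:R)^-1 *: sandwich A D B n| <= ((p%:R * p%:R * `|D|) *: exp_coeff c) n.
Proof.
move=> Ac Bc.
have c0 : 0 <= c by apply: le_trans Ac; rewrite mulr_ge0.
have h : `|sandwich A D B n| <= n.+1%:R * (p%:R * p%:R * `|D| * c ^+ n).
  apply: le_trans (ler_norm_sum _ _ _) _.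
  rewrite mulr_natl -[X in _ *+ X]card_ord -sumr_const.
  apply: ler_sum => i _; have ni : (i <= n)%N by rewrite -ltnS.
  apply: le_trans (mx_norm_mul _ _) _.
  have cE : c ^+ n = c ^+ (n - i) * c ^+ i by rewrite -exprD subnK.
  rewrite [leRHS](_ : _ = p%:R * (p%:R * c ^+ (n - i) * `|D|) * c ^+ i); last first.
    by rewrite cE; ring.
  apply: ler_pM; rewrite ?mulr_ge0//; last exact: mx_norm_exp.
  rewrite ler_wpM2l//; apply: le_trans (mx_norm_mul _ _) _.
  by rewrite ler_wpM2r// ler_wpM2l// mx_norm_exp.
rewrite normrZ ger0_norm ?invr_ge0//.
rewrite [leRHS](_ : _ = (n.+1`!%:R)^-1 * (n.+1%:R * (p%:R * p%:R * `|D| * c ^+ n))).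
  by rewrite ler_wpM2l ?invr_ge0.
rewrite [LHS](_ : _ = p%:R * p%:R * `|D| * (c ^+ n / n`!%:R))// factS natrM.
have n0 : n`!%:R != 0 :> R by rewrite pnatr_eq0 -lt0n fact_gt0.
have n1 : n.+1%:R != 0 :> R by rewrite pnatr_eq0.
by field; rewrite n0 -natr1 addrC in n1 *.
Qed.

Lemma cvgn_scale_exp_coeff (K c : R) : cvgn (series (K *: exp_coeff c)).
Proof. by apply: is_cvg_seriesZ; exact: is_cvg_series_exp_coeff. Qed.

Lemma cvgn_sandwich A D B :
  cvgn [normed series (fun n => (n.+1`!%:R)^-1 *: sandwich A D B n)].
Proof.
apply: cvgn_series_norm_le (@cvgn_scale_exp_coeff (p%:R * p%:R * `|D|)
  (p%:R * `|A| + p%:R * `|B|)) => n.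
by apply: mx_norm_sandwich; rewrite ?lerDl ?lerDr mulr_ge0.
Qed.

Lemma expmB A B :
  expm A - expm B = mxseries (fun n => (n.+1`!%:R)^-1 *: sandwich A (A - B) B n).
Proof.
have cA := cvg_mxseries (@cvgn_expm A); have cB := cvg_mxseries (@cvgn_expm B).
rewrite mxseriesE; apply/esym/cvg_lim => //.
(* The constant terms of the two exponentials cancel, so [N] terms here match [N.+1] terms there. *)
rewrite (_ : series _ = fun N => series (fun k => (k`!%:R)^-1 *: A ^+ k) N.+1 -
    series (fun k => (k`!%:R)^-1 *: B ^+ k) N.+1).
  have h := cvgB cA cB; rewrite -cvg_shiftS in h. exact: h.
apply/funext => N; rewrite /series/= !big_nat_recl//= opprD addrACA subrr add0r -sumrB.
by apply: eq_bigr => n _; rewrite -scalerBr subrX_sandwich.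
Qed.

Lemma cvg_sandwich (T : Type) (F : set_system T) {FF : Filter F}
    (f g : T -> 'M[R]_p) A D B n :
  f x @[x --> F] --> A -> g x @[x --> F] --> D ->
  sandwich (f x) (g x) B n @[x --> F] --> sandwich A D B n.
Proof.
move=> fA gD; apply: cvg_sumr => i _; apply: cvg_mulmx; last exact: cvg_cst.
by apply: cvg_mulmx => //; exact: cvg_mxexp.
Qed.

(** The series in [expmB] is linear in the middle factor, so the scalar moves inside and dominated
    convergence gives the limit. The general filter and scaling cover both one-parameter groups and
    curves [wedge (zeta s)]. *)
Lemma expm_quotient (T : Type) (F : set_system T) {FF : ProperFilter F}
    (Z : T -> 'M[R]_p) (h : T -> R) A D :
  Z x @[x --> F] --> A -> (h x)^-1 *: (Z x - A) @[x --> F] --> D ->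
  (h x)^-1 *: (expm (Z x) - expm A) @[x --> F] -->
  mxseries (fun n => (n.+1`!%:R)^-1 *: sandwich A D A n).
Proof.
move=> ZA ZD; pose f x n := (n.+1`!%:R)^-1 *: sandwich (Z x) ((h x)^-1 *: (Z x - A)) A n.
have -> : (fun x => (h x)^-1 *: (expm (Z x) - expm A)) = fun x => limn (series (f x)).
  apply/funext => x; rewrite expmB -mxseriesE.
  rewrite -[LHS](mxseries_linear ( *:%R (h x)^-1) (@cvgn_sandwich _ _ _)).
  apply: eq_mxseries => n; rewrite /f /sandwich /= scalerA mulrC -scalerA; congr (_ *: _).
  by rewrite scaler_sumr; apply: eq_bigr => i _; rewrite -scalemxAr -scalemxAl.
rewrite mxseriesE.
(* The margin 1 makes these bounds hold for [Z x] and for its quotients eventually along [F]. *)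
pose c : R := p%:R * (`|A| + 1); pose d : R := `|D| + 1.
apply: (@dominated_mxseries_cvg _ _ _ _ _ _ _ _ ((p%:R * p%:R * d) *: exp_coeff c)).
- exact: cvgn_scale_exp_coeff.
- have A1 : `|A| < `|A| + 1 by rewrite ltrDl.
  have D1 : `|D| < d by rewrite ltrDl.
  have nA : \forall x \near F, `|Z x| < `|A| + 1 by exact: cvgr_norm_lt ZA _ A1.
  have nD : \forall x \near F, `|(h x)^-1 *: (Z x - A)| < d.
    by exact: cvgr_norm_lt ZD _ D1.
  near=> x => n.
  have xA : `|Z x| < `|A| + 1 by near: x.
  have xD : `|(h x)^-1 *: (Z x - A)| < d by near: x.
  apply: le_trans (mx_norm_sandwich (c := c) _ _ _ _) _.
  + by apply: ler_wpM2l => //; exact: ltW.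
  + by apply: ler_wpM2l => //; exact: ltW.
  + apply: ler_wpM2r; last by rewrite ler_wpM2l// ltW.
    by apply: exp_coeff_ge0; rewrite mulr_ge0// addr_ge0.
- by move=> n; apply: cvgZl_tmp; exact: cvg_sandwich.
Unshelve. all: by end_near. Qed.

End Expm.

(** * Lie algebras *)

Section LinearRange.
Context {R : realType} {p q r s : nat}.
Variable g : {linear 'M[R]_(p, q) -> 'M[R]_(r, s)}.

Lemma range_linearP v : range g v <-> mxvec v *m cokermx (lin_mx g) = 0.
Proof.
split=> [[u _ <-]|/eqP]; first by rewrite -mul_vec_lin -mulmxA mulmx_coker mulmx0.
rewrite -submxE => /submxP[D vD]; exists (vec_mx D) => //.
by apply: (can_inj mxvecK); rewrite -mul_vec_lin vec_mxK.
Qed.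

Lemma range_linear_sub u v : range g u -> range g v -> range g (u - v).
Proof. by move=> [a _ <-] [b _ <-]; exists (a - b) => //; rewrite linearB. Qed.

Lemma range_linear_scale c v : range g v -> range g (c *: v).
Proof. by move=> [a _ <-]; exists (c *: a) => //; rewrite linearZ. Qed.

(** By [range_linearP] the range is the zero set of a linear, hence continuous, map, so it is
    closed. *)
Lemma cvg_range_linear (T : Type) (F : set_system T) {FF : ProperFilter F}
    (f : T -> 'M[R]_(r, s)) (l : 'M[R]_(r, s)) :
  (forall x, range g (f x)) -> f x @[x --> F] --> l -> range g l.
Proof.
move=> fg fl; apply/range_linearP.
pose C := cokermx (lin_mx g).
have h : mxvec (f x) *m C @[x --> F] --> mxvec l *m C.
  exact: (cvg_linear (g := mulmxr C \o mxvec) fl).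
rewrite -[LHS](cvg_lim _ h)//=; apply: lim_near_cst => //.
by near=> x; apply/range_linearP/fg.
Unshelve. all: by end_near. Qed.

End LinearRange.

(** Differentiability implies continuity: [f] is [a] plus [h] times a convergent quotient. *)
Lemma cvg_of_quotient (R : realType) (T : Type) (F : set_system T) {FF : Filter F}
    (p q : nat) (f : T -> 'M[R]_(p, q)) (h : T -> R) (a d : 'M[R]_(p, q)) :
  (\forall x \near F, h x != 0) -> h x @[x --> F] --> 0 ->
  (h x)^-1 *: (f x - a) @[x --> F] --> d -> f x @[x --> F] --> a.
Proof.
move=> h0 hF fF.
have : h x *: ((h x)^-1 *: (f x - a)) + a @[x --> F] --> 0 *: d + a.
  by apply: cvgD; [exact: cvgZ|exact: cvg_cst].
rewrite scale0r add0r; apply: cvg_trans; apply: near_eq_cvg.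
by near=> x; rewrite scalerA mulfV ?scale1r ?subrK//; near: x.
Unshelve. all: by end_near. Qed.

Lemma near_dnbhs_neq0 (R : realType) : \forall h \near (0 : R)^', h != 0.
Proof. exact: nbhs_dnbhs_neq. Qed.

Lemma cvg_dnbhs_id (R : realType) : h @[h --> (0 : R)^'] --> (0 : R).
Proof. exact: nbhs_dnbhs. Qed.

Lemma expm_scale_quotient (R : realType) (p : nat) (A : 'M[R]_p) :
  h^-1 *: (expm (h *: A) - 1%:M) @[h --> (0 : R)^'] --> A.
Proof.
have A0 : h *: A @[h --> (0 : R)^'] --> (0 : 'M[R]_p).
  by rewrite -(scale0r A); apply: cvgZr_tmp; exact: cvg_dnbhs_id.
have AA : h^-1 *: (h *: A - 0) @[h --> (0 : R)^'] --> A.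
  apply: cvg_near_cst; near=> h.
  rewrite subr0 scalerA mulVf ?scale1r//; near: h; exact: near_dnbhs_neq0.
(* At the base point 0 only the term of index 0 survives. *)
have SA : mxseries (fun k => (k.+1`!%:R)^-1 *: sandwich 0 A 0 k) = A.
  rewrite mxseries1 => [|k]; last first.
    by rewrite sandwichS mxexp0S mul0mx mulmx0 addr0 scaler0.
  by rewrite /sandwich big_ord1 !expr0 mul1mx mulmx1 factS fact0 muln1 invr1 scale1r.
rewrite -[X in _ --> X]SA -expm0; exact: (expm_quotient A0 AA).
Unshelve. all: by end_near. Qed.

Lemma expm_conj (R : realType) (p : nat) (X A : 'M[R]_p) : X \in unitmx ->
  expm (X *m A *m invmx X) = X *m expm A *m invmx X.
Proof.
move=> uX.
rewrite -[RHS](mxseries_linear (mulmxr (invmx X) \o mulmx X) (@cvgn_expm _ _ A)).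
apply: eq_mxseries => k /=; rewrite -scalemxAr -scalemxAl; congr (_ *: _).
elim: k => [|k IH]; first by rewrite !expr0 mulmx1 mulmxV.
by rewrite !mxexpS IH !mulmxA mulmxKV.
Qed.

Section LieAlgebra.
Context {R : realType} {m n : nat}.
Variables (G : set 'M[R]_m) (wedge : {linear 'cV[R]_n -> 'M[R]_m}).
Hypotheses (LG : matrix_Lie_group G) (wG : range wedge = lie_algebra G).

(** The exponential commutes with conjugation, so the one-parameter group of the conjugate is
    conjugate inside [G]. *)
Lemma range_wedge_conj X A :
  G X -> range wedge A -> range wedge (X *m A *m invmx X).
Proof.
case: LG => _ Gu GM GV _ GX; rewrite wG => GA t.
rewrite scalemxAl scalemxAr expm_conj; last exact: Gu.
by apply: (GM) (GV _ GX); exact: GM.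
Qed.

(* The bracket is the derivative at 0 of [t |-> exp(tA) B exp(-tA)], a curve in
   the range of [wedge], which is closed because it is finite-dimensional. *)
Lemma range_wedge_bracket A B :
  range wedge A -> range wedge B -> range wedge (A *m B - B *m A).
Proof.
move=> wA wB; have GA : lie_algebra G A by rewrite -wG.
pose Q (C : 'M[R]_m) (t : R) := t^-1 *: (expm (t *: C) - 1%:M).
(* This is the quotient [t^-1 (exp(tA) B exp(-tA) - B)], factored so that the limits [A B - B A] and
   1 of its factors are visible. *)
pose f t := (Q A t *m B - B *m Q A t) *m expm (t *: - A).
have wf t : range wedge (f t).
  rewrite /f scalerN -invmx_expm.
  have -> : (Q A t *m B - B *m Q A t) *m invmx (expm (t *: A)) =
      t^-1 *: (expm (t *: A) *m B *m invmx (expm (t *: A)) - B).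
    rewrite /Q -scalemxAl -scalemxAr -scalerBr -scalemxAl; congr (_ *: _).
    rewrite [(_ - 1%:M) *m B]mulmxBl mulmxBr mul1mx mulmx1 opprB addrA subrK mulmxBl.
    by rewrite mulmxK// expm_unit.
  apply: range_linear_scale; apply: range_linear_sub => //.
  by apply: range_wedge_conj => //; exact: GA.
have fl : f t @[t --> (0 : R)^'] --> (A *m B - B *m A) *m 1%:M; last first.
  by rewrite -[_ - _]mulmx1; exact: (cvg_range_linear wf fl).
apply: cvg_mulmx.
  by apply: cvgB; apply: cvg_mulmx; (try exact: cvg_cst); exact: expm_scale_quotient.
apply: (@cvg_of_quotient _ _ _ _ _ _ _ id _ (- A)).
- exact: near_dnbhs_neq0.
- exact: cvg_dnbhs_id.
- exact: expm_scale_quotient.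
Qed.

(** No linearity of [vee] is assumed: the values of [f] lie in the range of [wedge], where
    [wedge (vee v) = v], and [wedge] and [f] are linear. *)
Lemma wedge_mx_of_lin (vee : 'M[R]_m -> 'cV[R]_n)
    (f : {linear 'cV[R]_n -> 'M[R]_m}) y :
  cancel wedge vee -> (forall u, range wedge (f u)) ->
  wedge (mx_of_lin (fun u => vee (f u)) *m y) = f y.
Proof.
move=> wK wf.
have -> : mx_of_lin (fun u => vee (f u)) *m y =
    \sum_j y j 0 *: vee (f (delta_mx j 0)).
  apply/colP => i; rewrite mxE summxE; apply: eq_bigr => j _.
  by rewrite !mxE mulrC.
rewrite linear_sum {2}(matrix_sum_delta y) linear_sum; apply: eq_bigr => j _.
rewrite big_ord1 !linearZ /=; congr (_ *: _).
by have [u _ <-] := wf (delta_mx j 0); rewrite wK.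
Qed.

End LieAlgebra.

(** * The adjoint action of an exponential *)

Section Intertwining.
Context {R : realType} {m n : nat}.
Variables (wedge : {linear 'cV[R]_n -> 'M[R]_m}) (Z : 'M[R]_m) (M : 'M[R]_n).
Hypothesis ZM : forall u, wedge (M *m u) = Z *m wedge u - wedge u *m Z.
Variable y : 'cV[R]_n.

Let W k := wedge ((- M) ^+ k *m y).

Let WZ k : W k *m Z = Z *m W k + W k.+1.
Proof.
by rewrite /W mxexpS -mulmxA mulNmx linearN /= ZM opprB addrCA subrr addr0.
Qed.

Let W_bound : exists C, forall k, `|W k| <= C * (n%:R * `|- M|) ^+ k.
Proof.
have [C C0 wC] := linear_mx_bounded wedge.
exists (C * (n%:R * `|y|)) => k; apply: le_trans (wC _) _.
rewrite -mulrA ler_wpM2l//; apply: le_trans (mx_norm_mul _ _) _.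
by rewrite mulrAC ler_wpM2l ?mulr_ge0// mx_norm_exp.
Qed.

Let mxseries_W (a : nat -> R) :
  cvgn [normed series (fun k => a k *: (- M) ^+ k)] ->
  mxseries (fun k => a k *: W k) = wedge (mxseries (fun k => a k *: (- M) ^+ k) *m y).
Proof.
move=> ca; rewrite -[RHS](mxseries_linear (wedge \o mulmxr y) ca).
by apply: eq_mxseries => k /=; rewrite -scalemxAl linearZ.
Qed.

(** This is [Ad_exp(-Z) = exp(-ad_Z)] in a form free of inverses. *)
Lemma expm_wedge : expm Z *m wedge (expm (- M) *m y) = wedge y *m expm Z.
Proof.
have [C WC] := W_bound.
rewrite -(mxseries_W (@cvgn_expm _ _ (- M))) (expm_twist WZ WC).
by rewrite /W expr0 mul1mx.
Qed.

(** The right side is the limit in [expm_quotient], so this puts the derivative of the exponential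
    in left-trivialized form. *)
Lemma expm_wedge_dexp : expm Z *m wedge (dexp_series M *m y) =
  mxseries (fun k => (k.+1`!%:R)^-1 *: sandwich Z (wedge y) Z k).
Proof.
have [C WC] := W_bound; rewrite dexp_seriesE.
rewrite -(mxseries_W (@cvgn_dexp _ _ M)) (expm_twist_sandwich WZ WC).
by rewrite /W expr0 mul1mx.
Qed.

End Intertwining.

(** The inverse of [- exp(-M) D^-1] is [- D exp(M)], where [D = dexp_series M]; [D] commutes with
    [exp(M)], and [expm_mul_dexp] sums the product. *)
Lemma U_mx_inv (R : realType) (n : nat) (M : 'M[R]_n) :
  dexp_series M \in unitmx ->
  U_mx M \in unitmx /\
  invmx (U_mx M) = - mxseries (fun k => (k.+1`!%:R)^-1 *: M ^+ k).
Proof.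
move=> uD; rewrite -expm_mul_dexp.
have UV : U_mx M *m (- (expm M *m dexp_series M)) = 1%:M.
  have -> : expm M *m dexp_series M = dexp_series M *m expm M.
    exact: comm_expm_dexp.
  by rewrite /U_mx mulmxN mulNmx opprK -mulmxA mulKmx// -{2}(opprK M) expmN.
have [uU _] := mulmx1_unit UV; split => //.
by rewrite -[LHS]mulmx1 -UV mulKmx.
Qed.

(** * Differentiation along curves and the error equation *)

Lemma is_derive_cvg (R : realType) (p q : nat) (f : R -> 'M[R]_(p, q)) t d :
  is_derive t (1 : R) f d ->
  h^-1 *: (f (h + t) - f t) @[h --> (0 : R)^'] --> d.
Proof.
case=> df <-; move: (df); rewrite /derivable /derive.
have -> // : (fun h : R => h^-1 *: ((f \o shift t) (h *: (1 : R)) - f t)) =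
  (fun h => h^-1 *: (f (h + t) - f t)).
by apply/funext => h; rewrite /= [h *: 1]mulr1.
Qed.

(* Writing [Xbar = X exp(Z)] and differentiating the product avoids
   differentiating [invmx X]. *)
Lemma is_derive_mulmx_expm (R : realType) (m n : nat)
    (wedge : {linear 'cV[R]_n -> 'M[R]_m}) (X Xbar : R -> 'M[R]_m)
    (zeta : R -> 'cV[R]_n) (t : R) dX dXbar dz :
  (forall s, Xbar s = X s *m expm (wedge (zeta s))) ->
  is_derive t (1 : R) X dX -> is_derive t (1 : R) Xbar dXbar ->
  is_derive t (1 : R) zeta dz ->
  dXbar = dX *m expm (wedge (zeta t)) + X t *m
    mxseries (fun k => (k.+1`!%:R)^-1 *:
      sandwich (wedge (zeta t)) (wedge dz) (wedge (zeta t)) k).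
Proof.
move=> XE /is_derive_cvg cX /is_derive_cvg cXbar /is_derive_cvg cz.
have cZ : h^-1 *: (wedge (zeta (h + t)) - wedge (zeta t)) @[h --> (0 : R)^'] -->
    wedge dz.
  rewrite (_ : (fun _ => _) = fun h => wedge (h^-1 *: (zeta (h + t) - zeta t))).
    exact: (cvg_linear (g := wedge) cz).
  by apply/funext => h; rewrite -linearB linearZ_LR.
have n0 := near_dnbhs_neq0 R; have h0 := @cvg_dnbhs_id R.
set S := mxseries _; pose E s := expm (wedge (zeta s)).
have cE : h^-1 *: (E (h + t) - E t) @[h --> (0 : R)^'] --> S.
  exact: (expm_quotient (cvg_of_quotient n0 h0 cZ) cZ).
have cE0 : E (h + t) @[h --> (0 : R)^'] --> E t.
  exact: (cvg_of_quotient n0 h0 cE).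
rewrite -(cvg_lim _ cXbar)//; apply: cvg_lim => //.
(* Product rule: the first term needs the continuity [cE0] of [E], the second its derivative
   [cE]. *)
rewrite (_ : (fun h => _) = fun h => (h^-1 *: (X (h + t) - X t)) *m E (h + t) +
    X t *m (h^-1 *: (E (h + t) - E t))).
  by apply: cvgD; apply: cvg_mulmx => //; exact: cvg_cst.
apply/funext => h; rewrite !XE -scalemxAl -scalemxAr -scalerDr; congr (_ *: _).
by rewrite mulmxBl mulmxBr addrA subrK.
Qed.

Unset Implicit Arguments.
Set Strict Implicit.

Theorem theorem1 (R : realType) (m n : nat) (G : set 'M[R]_m)
  (wedge : {linear 'cV[R]_n -> 'M[R]_m}) (vee : 'M[R]_m -> 'cV[R]_n)
  (X Xbar : R -> 'M[R]_m) (l r lbar rbar zeta : R -> 'cV[R]_n) :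
  matrix_Lie_group G ->
  injective wedge ->
  range wedge = lie_algebra G ->
  cancel wedge vee ->
  (forall t, G (X t)) -> (forall t, G (Xbar t)) ->
  (forall t, is_derive t (1 : R) X (X t *m wedge (l t) + wedge (r t) *m X t)) ->
  (forall t, is_derive t (1 : R) Xbar (Xbar t *m wedge (lbar t) + wedge (rbar t) *m Xbar t)) ->
  (forall t, derivable zeta t (1 : R)) ->
  (forall t, invmx (X t) *m Xbar t = expm (wedge (zeta t))) ->
  (forall t, dexp_series (ad_mx wedge vee (zeta t)) \in unitmx) ->
  forall t,
    let ad_z := ad_mx wedge vee (zeta t) in
    let Ul := U_mx ad_z in
    let ul := l t - lbar t in
    let ur := r t - rbar t in
    [/\ 'D_(1 : R) zeta t = - (ad_mx wedge vee (lbar t) *m zeta t)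
                      + Ul *m (ul + Ad_mx wedge vee (invmx (X t)) *m ur),
        Ul \in unitmx &
        invmx Ul = - mxseries (fun k => ((k.+1)`!%:R)^-1 *: (ad_z ^+ k))].
Proof.
move=> LG winj wG wK GX _ dX dXbar dz XE uD t M U ul ur.
have [uX uV] : X t \in unitmx /\ forall y, range wedge (wedge y).
  by split=> [|y]; [case: LG => _ Gu _ _ _; exact: Gu|exists y].
have adE z y : wedge (ad_mx wedge vee z *m y) =
    wedge z *m wedge y - wedge y *m wedge z.
  apply: (wedge_mx_of_lin
    (f := (mulmx (wedge z) \o wedge) \- (mulmxr (wedge z) \o wedge))) => // u.
  exact: range_wedge_bracket LG wG _ _ (uV z) (uV u).
have AdE y : wedge (Ad_mx wedge vee (invmx (X t)) *m y) =
    invmx (X t) *m wedge y *m X t.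
  (* [Ad_mx] at [invmx (X t)] carries a double inverse on the right. *)
  rewrite -{3}(invmxK (X t)).
  apply: (wedge_mx_of_lin
    (f := mulmxr (invmx (invmx (X t))) \o (mulmx (invmx (X t)) \o wedge))) => // u.
  apply: (range_wedge_conj LG wG _ (uV u)).
  by case: LG => _ _ _ GV _; exact: GV.
have XbarE s : Xbar s = X s *m expm (wedge (zeta s)).
  by rewrite -XE mulKVmx//; case: LG => _ Gu _ _ _; exact: Gu.
have [UU Uinv] := U_mx_inv (uD t).
split=> //.
set w := ul + _.
have key : dexp_series M *m 'D_1 zeta t = lbar t - expm (- M) *m (lbar t + w).
  apply: winj; rewrite linearB/=.
  have := is_derive_mulmx_expm XbarE (dX t) (dXbar t) (derivableP (dz t)).
  rewrite -(expm_wedge_dexp (adE (zeta t))) -/M.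
  set E := expm _; set D := wedge (_ *m _) => h.
  have uE : E \in unitmx by exact: expm_unit.
  (* After multiplication by [E] on the left, [expm_wedge] replaces [E *m wedge (expm (- M) *m v)]
     by [wedge v *m E]. *)
  suff : E *m D = E *m wedge (lbar t) - wedge (lbar t + w) *m E.
    rewrite -(expm_wedge (adE (zeta t))) -/E -/M -mulmxBr => /(congr1 (mulmx (invmx E))).
    by rewrite !mulKmx.
  (* Multiplying the two expressions of the derivative of [Xbar] by [invmx (X t)] isolates [E *m D];
     the [r] and [rbar] terms combine into the conjugate of [wedge ur]. *)
  have := congr1 (mulmx (invmx (X t))) h.
  rewrite XbarE -/E mulmxDr !mulmxDl !mulmxDr -!mulmxA !(mulKmx uX) => /(canLR (addKr _)) <-.
  have -> : lbar t + w = l t + Ad_mx wedge vee (invmx (X t)) *m ur.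
    by rewrite /w /ul addrA [lbar t + _]addrC subrK.
  rewrite [wedge (_ + _)]linearD AdE [wedge ur]linearB mulmxDl mulmxBr !mulmxBl -!mulmxA.
  by rewrite addrCA !opprD opprK -!addrA.
have uM : dexp_series M \in unitmx by exact: uD.
have DK := mulKmx uM ('D_1 zeta t).
rewrite -DK key [expm (- M) *m _]mulmxDr opprD addrA mulmxBr.
(* The factor [dexp_series M] then cancels against its inverse, leaving [M *m lbar t], which
   antisymmetry of the bracket turns into the drift term. *)
have -> : lbar t - expm (- M) *m lbar t = dexp_series M *m (M *m lbar t).
  by rewrite mulmxA dexp_mul mulmxBl mul1mx.
rewrite (mulKmx uM); congr (_ + _).
  by apply: winj; rewrite linearN /= !adE opprB.
rewrite /U /U_mx mulNmx !mulmxA; congr (- (_ *m _)).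
have cM : - M *m M = M *m - M by rewrite mulmxN mulNmx.
(* The inverse of [dexp_series M] stands left of [expm (- M)] here and right of it in [U_mx]; the
   two commute. *)
by rewrite -[RHS](mulKmx uM) [dexp_series M *m _]mulmxA -(comm_expm_dexp cM) (mulmxK uM).
Qed.
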